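(* Let $\sigma\ge 0$, $\alpha\ge 0$ be constants and consider the Laplace–Fourier transformed PML model in the two half-planes $y>0$ ($i=1$) and $y<0$ ($i=2$) with piecewise constant orthotropic elastic parameters and the PML interface conditions at $y=0$. Assume that the PML Cauchy problem has no temporally growing modes (for the material of each of the two layers). Assume that the interface wave modes of the undamped problem are stable, that is, for every $k_x\in\mathbb{R}$ the roots $s$ of $\mathcal{F}(s,k_x)=0$ are of the form $s=\mathbf{i}\xi$ with $\xi\in\mathbb{R}$. Then all these interface wave modes are dissipated by the PML, i.e. for every $k_x\in\mathbb{R}$, $\mathcal{F}(s,\widetilde k_x)=0$ with $\widetilde k_x=k_x/S_x(s)$ implies $\Re s\le 0$.
   Context: Notation: $\mathbf{i}=\sqrt{-1}$. For each layer $i=1,2$ the medium has constant density $\rho_i>0$ and constants $c_{11_i},c_{22_i},c_{33_i}>0$, $c_{12_i}\in\mathbb{R}$ with $c_{11_i}c_{22_i}-c_{12_i}^2>0$, and $$A_i=\begin{bmatrix}c_{11_i}&0\\0&c_{33_i}\end{bmatrix},\quad B_i=\begin{bmatrix}c_{33_i}&0\\0&c_{22_i}\end{bmatrix},\quad C_i=\begin{bmatrix}0&c_{12_i}\\c_{33_i}&0\end{bmatrix}.$$ PML metric: $S_x=S_x(s)=1+\dfrac{\sigma}{\alpha+s}$, where $\sigma\ge0$ is the damping and $\alpha\ge0$ the complex frequency shift; $\widetilde k_x=k_x/S_x$. PML model (Laplace transform in $t$ with dual variable $s$, Fourier transform in $x$ with dual variable $k_x$): for $i=1,2$, $$\rho_i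 s^2\widetilde{\mathbf u}_i=-\widetilde k_x^2A_i\widetilde{\mathbf u}_i+B_i\frac{d^2\widetilde{\mathbf u}_i}{dy^2}+\mathbf{i}\widetilde k_x(C_i+C_i^T)\frac{d\widetilde{\mathbf u}_i}{dy},$$ with interface conditions at $y=0$: $\widetilde{\mathbf u}_1=\widetilde{\mathbf u}_2$ and $B_1\frac{d\widetilde{\mathbf u}_1}{dy}+\mathbf{i}\widetilde k_xC_1^T\widetilde{\mathbf u}_1=B_2\frac{d\widetilde{\mathbf u}_2}{dy}+\mathbf{i}\widetilde k_xC_2^T\widetilde{\mathbf u}_2$. For $\sigma=0$ one has $\widetilde k_x=k_x$ and this is the undamped problem. Characteristic function: for $s,k,\kappa\in\mathbb{C}$, $$\mathcal{P}_i(k,\kappa)=\frac{k^2A_i-\kappa^2B_i-\mathbf{i}k\kappa(C_i+C_i^T)}{\rho_i},\qquad F_i(s,k,\kappa)=\det\big(s^2I+\mathcal{P}_i(k,\kappa)\big).$$ No growing Cauchy modes: the PML Cauchy problem (constant-coefficient PML in the whole plane, no interface) for material $i$ has no temporally growing modes if there are no $(k_x,k_y)\in\mathbb{R}^2$ and $s$ with $\Re s>0$ such that $F_i(s,k_x/S_x(s),\mathbf{i}k_y)=0$. Roots: for $\Re s>0$ and $k=k_x\in\mathbb{R}$, or $k=\widetilde k_x$ under the assumption of no growing Cauchy modes, the equation $F_i(s,k,\kappa)=0$ has four roots $\kappa$ (with multiplicity): $\kappa_{i1}^-,\kappa_{i2}^-$ with negative real part and $\kappa_{i1}^+,\kappa_{i2}^+$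 with positive real part. Let $\Phi_{1j}\in\mathbb{C}^2$ ($j=1,2$) be eigenvectors, i.e. nonzero solutions of $(s^2I+\mathcal{P}_1(k,\kappa_{1j}^-))\Phi_{1j}=0$, and $\Phi_{2j}$ nonzero solutions of $(s^2I+\mathcal{P}_2(k,\kappa_{2j}^+))\Phi_{2j}=0$ (for a double root with two-dimensional eigenspace the two eigenvectors are taken linearly independent), scaled so that they are homogeneous of degree zero in $(s,k)$. Interface matrix and determinant: $\mathcal{F}(s,k)=\det\mathcal{C}(s,k)$ where $\mathcal{C}(s,k)$ is the $4\times4$ matrix $$\mathcal{C}(s,k)=\begin{bmatrix}\Phi_{11}&\Phi_{12}&-\Phi_{21}&-\Phi_{22}\\(\kappa_{11}^-B_1+\mathbf{i}kC_1^T)\Phi_{11}&(\kappa_{12}^-B_1+\mathbf{i}kC_1^T)\Phi_{12}&-(\kappa_{21}^+B_2+\mathbf{i}kC_2^T)\Phi_{21}&-(\kappa_{22}^+B_2+\mathbf{i}kC_2^T)\Phi_{22}\end{bmatrix}.$$ Its null vectors give the modes decaying as $|y|\to\infty$: $\sum_j\delta_{1j}e^{\kappa_{1j}^-y}\Phi_{1j}$ for $y>0$ and $\sum_j\delta_{2j}e^{\kappa_{2j}^+y}\Phi_{2j}$ for $y<0$. A mode is dissipated by the PML in the sense stated in the claim. *)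

(* Defs.v *)
From HB Require Import structures.
From mathcomp Require Import all_boot all_order all_algebra.
From mathcomp Require Import reals.
From mathcomp Require Export complex.

Set Implicit Arguments.
Unset Strict Implicit.
Unset Printing Implicit Defensive.

Import Order.TTheory GRing.Theory Num.Theory.

Local Open Scope ring_scope.
Local Open Scope complex_scope.

Record material (R : realType) := Material {
  rho : R; c11 : R; c22 : R; c33 : R; c12 : R;
  rho_gt0 : 0 < rho;
  c11_gt0 : 0 < c11;
  c22_gt0 : 0 < c22;
  c33_gt0 : 0 < c33;
  c12_lt : 0 < c11 * c22 - c12 ^+ 2 }.

Definition mx22 (T : Type) (a b c d : T) : 'M[T]_2 :=
  \matrix_(i, j) if i == ord0 then (if j == ord0 then a else b)
                 else (if j == ord0 then c else d).

Section Symbols.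
Variables (R : realType) (m : material R).

Definition Amx : 'M[R[i]]_2 := mx22 (c11 m)%:C 0 0 (c33 m)%:C.
Definition Bmx : 'M[R[i]]_2 := mx22 (c33 m)%:C 0 0 (c22 m)%:C.
Definition Cmx : 'M[R[i]]_2 := mx22 0 (c12 m)%:C (c33 m)%:C 0.

Definition Pmx (k kappa : R[i]) : 'M[R[i]]_2 :=
  ((rho m)%:C)^-1 *:
    (k ^+ 2 *: Amx - kappa ^+ 2 *: Bmx - ('i%C * k * kappa) *: (Cmx + Cmx^T)).

Definition symbol (s k kappa : R[i]) : 'M[R[i]]_2 :=
  (s ^+ 2)%:M + Pmx k kappa.

Definition charF (s k kappa : R[i]) : R[i] := \det (symbol s k kappa).

(* The roots of the quartic charF s k are counted with multiplicity: the
   polynomial function charF s k is a nonzero constant times the product of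
   the four linear factors. *)
Definition root_split (s k : R[i]) (kneg kpos : 'I_2 -> R[i]) : Prop :=
  (exists2 c : R[i], c != 0 &
     forall z, charF s k z = c * \prod_(j < 2) ((z - kneg j) * (z - kpos j)))
  /\ (forall j, complex.Re (kneg j) < 0 /\ 0 < complex.Re (kpos j)).

Definition splits (s k : R[i]) : Prop :=
  exists kneg kpos, root_split s k kneg kpos.

Definition displacement_mx (Phi : 'I_2 -> 'cV[R[i]]_2) : 'M[R[i]]_2 :=
  \matrix_(a, j) Phi j a ord0.

Definition traction_mx (k : R[i]) (kappa : 'I_2 -> R[i])
    (Phi : 'I_2 -> 'cV[R[i]]_2) : 'M[R[i]]_2 :=
  \matrix_(a, j) ((kappa j *: Bmx + ('i%C * k) *: Cmx^T) *m Phi j) a ord0.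

(* The columns of cokermx M span {v | M *m v = 0}, so its rank is the
   dimension of the eigenspace.  At a double root with a one-dimensional
   eigenspace the two eigenvectors are necessarily parallel. *)
Definition eigenvectors (s k : R[i]) (kappa : 'I_2 -> R[i])
    (Phi : 'I_2 -> 'cV[R[i]]_2) : Prop :=
  (forall j, Phi j != 0 /\ symbol s k (kappa j) *m Phi j = 0)
  /\ (kappa ord0 = kappa ord_max ->
      \rank (cokermx (symbol s k (kappa ord0))) = 2%N ->
      \rank (displacement_mx Phi) = 2%N).

(* Homogeneity is with respect to positive real factors: these preserve the
   signs of the real parts of the roots, a general complex factor does not. *)
Definition homogeneous0 (Phi : R[i] -> R[i] -> 'I_2 -> 'cV[R[i]]_2) : Prop :=
  forall (l : R) (s k : R[i]) (j : 'I_2), 0 < l -> splits s k ->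
    Phi (l%:C * s) (l%:C * k) j = Phi s k j.

End Symbols.

(* A choice of roots and eigenvectors for the layers y > 0 (m1) and y < 0 (m2),
   constrained at each (s, k) where the four roots split into two with negative
   and two with positive real part.  The eigenvectors belong to the modes
   decaying away from y = 0: roots kneg1 for y > 0 and kpos2 for y < 0. *)
Record interface_modes (R : realType) (m1 m2 : material R) := InterfaceModes {
  kneg1 : R[i] -> R[i] -> 'I_2 -> R[i];
  kpos1 : R[i] -> R[i] -> 'I_2 -> R[i];
  kneg2 : R[i] -> R[i] -> 'I_2 -> R[i];
  kpos2 : R[i] -> R[i] -> 'I_2 -> R[i];
  Phi1 : R[i] -> R[i] -> 'I_2 -> 'cV[R[i]]_2;
  Phi2 : R[i] -> R[i] -> 'I_2 -> 'cV[R[i]]_2;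
  roots1 : forall s k, splits m1 s k ->
    root_split m1 s k (kneg1 s k) (kpos1 s k);
  roots2 : forall s k, splits m2 s k ->
    root_split m2 s k (kneg2 s k) (kpos2 s k);
  eigen1 : forall s k, splits m1 s k ->
    eigenvectors m1 s k (kneg1 s k) (Phi1 s k);
  eigen2 : forall s k, splits m2 s k ->
    eigenvectors m2 s k (kpos2 s k) (Phi2 s k);
  homog1 : homogeneous0 m1 Phi1;
  homog2 : homogeneous0 m2 Phi2 }.

Section Interface.
Variables (R : realType) (m1 m2 : material R) (M : interface_modes m1 m2).

Definition interface_mx (s k : R[i]) : 'M[R[i]]_(2 + 2) :=
  block_mx (displacement_mx (Phi1 M s k)) (- displacement_mx (Phi2 M s k))
           (traction_mx m1 k (kneg1 M s k) (Phi1 M s k))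
           (- traction_mx m2 k (kpos2 M s k) (Phi2 M s k)).

Definition interface_det (s k : R[i]) : R[i] := \det (interface_mx s k).

(* interface_det s k is meaningful only where the roots of both layers split. *)
Definition interface_root (s k : R[i]) : Prop :=
  [/\ splits m1 s k, splits m2 s k & interface_det s k = 0].

End Interface.

Section PML.
Variables (R : realType) (sigma alpha : R).

Definition Sx (s : R[i]) : R[i] := 1 + sigma%:C / (alpha%:C + s).

Definition no_growing_Cauchy_modes (m : material R) : Prop :=
  ~ exists (kx ky : R) (s : R[i]),
      0 < complex.Re s /\ charF m s (kx%:C / Sx s) ('i%C * ky%:C) = 0.

End PML.

(* Main.v *)
(* Suppose Re s > 0 and put z = S_x(s), so that Re z > 0 and Re (z s) > 0.  The
   symbol is homogeneous of degree two, so x is a root at (s, kx / z) iff z x is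
   a root at (z s, kx).  If multiplication by z preserves the side of the
   imaginary axis on which each root lies, then decaying modes at (s, kx / z)
   are decaying modes at (z s, kx), and the two interface determinants vanish
   together; stability of the undamped problem makes z s imaginary, which
   contradicts Re (z s) > 0.

   The sides agree by a homotopy at fixed s: replace kx by t kx.  For no t is a
   root x imaginary (no growing Cauchy modes) nor z x (the undamped symbol is
   s^2 plus a positive semidefinite matrix), and at t = 0 all roots are real
   multiples of s.  The symbol is quadratic in x^2, and Re x Re (z x) is a
   continuous function of x^2, so its sign cannot change along the way. *)
Require Import Defs.
From HB Require Import structures.
From mathcomp Require Import all_boot all_order all_algebra.
From mathcomp Require Import reals.
From mathcomp Require Import ring lra.
From mathcomp Require Import topology normedtype realfun.

Set Implicit Arguments.
Unset Strict Implicit.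
Unset Printing Implicit Defensive.

Import Order.TTheory GRing.Theory Num.Theory.
Import numFieldNormedType.Exports.

Local Open Scope ring_scope.
Local Open Scope complex_scope.

(** * The symbol and its determinant *)

Lemma det_mx22E (K : comNzRingType) (a b c d : K) :
  \det (mx22 a b c d) = a * d - b * c.
Proof.
rewrite (expand_det_row _ ord0) !big_ord_recl big_ord0 /cofactor !det_mx11.
by rewrite !mxE /= addr0 expr0 expr1 mul1r mulN1r mulrN.
Qed.

Section Symbol.
Variables (R : realType) (m : material R).
Implicit Types s k kappa z : R[i].

Let rhoC_neq0 : (rho m)%:C != 0 :> R[i].
Proof. by rewrite (inj_eq (@complexI R)) gt_eqF// rho_gt0. Qed.

Lemma symbolE s k kappa : symbol m s k kappa =
  ((rho m)%:C)^-1 *: mx22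
    ((rho m)%:C * s ^+ 2 + (c11 m)%:C * k ^+ 2 - (c33 m)%:C * kappa ^+ 2)
    (- ('i%C * k * kappa * ((c12 m)%:C + (c33 m)%:C)))
    (- ('i%C * k * kappa * ((c12 m)%:C + (c33 m)%:C)))
    ((rho m)%:C * s ^+ 2 + (c33 m)%:C * k ^+ 2 - (c22 m)%:C * kappa ^+ 2).
Proof.
apply/matrixP => i j; rewrite /symbol /Pmx !mxE.
by move: i j => [[|[|//]] ?] [[|[|//]] ?] /=; rewrite ?mulr1n ?mulr0n; field.
Qed.

Lemma charFE s k kappa : charF m s k kappa = ((rho m)%:C ^+ 2)^-1 *
  (((rho m)%:C * s ^+ 2 + (c11 m)%:C * k ^+ 2 - (c33 m)%:C * kappa ^+ 2)
   * ((rho m)%:C * s ^+ 2 + (c33 m)%:C * k ^+ 2 - (c22 m)%:C * kappa ^+ 2)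
   + ((c12 m)%:C + (c33 m)%:C) ^+ 2 * k ^+ 2 * kappa ^+ 2).
Proof.
rewrite /charF symbolE detZ det_mx22E exprVn; congr (_ * _).
have gen (x y a : R[i]) : x * y - - ('i%C * a) * - ('i%C * a) = x * y + a ^+ 2.
  by rewrite mulrNN mulrACA -expr2 sqr_i mulN1r opprK expr2.
by rewrite -!['i%C * k * _]mulrA -!['i%C * _ * _]mulrA gen; congr (_ + _); ring.
Qed.

Lemma symbol_scale z s k kappa :
  symbol m (z * s) (z * k) (z * kappa) = z ^+ 2 *: symbol m s k kappa.
Proof.
rewrite !symbolE; apply/matrixP => i j; rewrite !mxE.
by case: ifP => _; case: ifP => _; ring.
Qed.

Lemma charF_scale z s k kappa :
  charF m (z * s) (z * k) (z * kappa) = z ^+ 4 * charF m s k kappa.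
Proof. by rewrite /charF symbol_scale detZ -exprM. Qed.

(* [charF m s k] is then a constant times [(z ^+ 2 - kappa ^+ 2) ^+ 2], so a
   two-dimensional eigenspace occurs only at a double root. *)
Lemma symbol0_double s k kappa z : kappa != 0 -> symbol m s k kappa = 0 ->
  charF m s k z = 0 -> z = kappa \/ z = - kappa.
Proof.
move=> kappa0 /matrixP S0.
rewrite symbolE in S0.
have := (S0 ord0 ord0, S0 ord0 ord_max, S0 ord_max ord_max).
rewrite !mxE /= charFE => -[[]] /eqP.
rewrite mulf_eq0 invr_eq0 (negPf rhoC_neq0) /= => /eqP E1 /eqP.
rewrite mulf_eq0 invr_eq0 (negPf rhoC_neq0) /= oppr_eq0.
have i0 : 'i%C != 0 :> R[i] by rewrite eq_complex /= oner_eq0 andbF.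
rewrite -mulrA -mulrA mulf_eq0 (negPf i0) /= mulrCA mulf_eq0.
rewrite (negPf kappa0) /= => /eqP E2 /eqP.
rewrite mulf_eq0 invr_eq0 (negPf rhoC_neq0) /= => /eqP E3 /eqP.
rewrite mulf_eq0 invr_eq0 expf_eq0 (negPf rhoC_neq0) /=.
set d := _ + _ in E2 *.
(* By [E1] and [E3] the diagonal entries at [z] are multiples of [kappa ^+ 2 - z ^+ 2]; [E2] removes
   the coupling term. *)
have shift (u v c : R[i]) : u + v - c * z ^+ 2
    = (u + v - c * kappa ^+ 2) + c * (kappa ^+ 2 - z ^+ 2) by ring.
rewrite !shift E1 E3 !add0r -exprMn [d * k]mulrC E2 expr0n mul0r addr0.
rewrite !mulf_eq0 !(inj_eq (@complexI R)) (gt_eqF (c33_gt0 m))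
  (gt_eqF (c22_gt0 m)) orbb /=.
by rewrite subr_eq0 eq_sym eqf_sqr => /orP[]/eqP; [left | right].
Qed.

(** For imaginary [kappa], [rho] times the symbol is [rho * s ^+ 2] plus a real symmetric positive
    semidefinite matrix. A zero determinant would make [s ^+ 2] real and nonpositive, which a
    positive real part of [s] excludes. *)
Lemma charF_imaginary_neq0 s (k y : R) : 0 < complex.Re s ->
  charF m s k%:C ('i%C * y%:C) != 0.
Proof.
move=> s0; rewrite charFE mulf_neq0 //; first by rewrite invr_eq0 expf_neq0.
(* The semidefinite matrix has diagonal entries [a], [b] and off-diagonal entry [e]. *)
pose a := c11 m * k ^+ 2 + c33 m * y ^+ 2.
pose b := c33 m * k ^+ 2 + c22 m * y ^+ 2.
pose e := (c12 m + c33 m) * k * y.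
set X := (rho m)%:C * s ^+ 2.
have iy2 : ('i%C * y%:C) ^+ 2 = - (y ^+ 2)%:C :> R[i].
  by rewrite exprMn sqr_i mulN1r rmorphXn.
have -> : (X + (c11 m)%:C * k%:C ^+ 2 - (c33 m)%:C * ('i%C * y%:C) ^+ 2)
   * (X + (c33 m)%:C * k%:C ^+ 2 - (c22 m)%:C * ('i%C * y%:C) ^+ 2)
   + ((c12 m)%:C + (c33 m)%:C) ^+ 2 * k%:C ^+ 2 * ('i%C * y%:C) ^+ 2
   = (X + a%:C) * (X + b%:C) - (e ^+ 2)%:C.
  by rewrite iy2 /a /b /e; ring.
have := rho_gt0 m; have := c11_gt0 m; have := c22_gt0 m; have := c33_gt0 m.
have := c12_lt m.
have : complex.Re X = rho m * (complex.Re s ^+ 2 - complex.Im s ^+ 2).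
  by rewrite /X; case: (s) => u v /=; ring.
have : complex.Im X = rho m * (complex.Re s * complex.Im s) * 2.
  by rewrite /X; case: (s) => u v /=; ring.
move: X => [p q] /= qE pE c12lt c33gt0 c22gt0 c11gt0 rhogt0.
have k2 := sqr_ge0 k; have y2 := sqr_ge0 y.
have a0 : 0 <= a by rewrite addr_ge0// mulr_ge0// ltW.
have b0 : 0 <= b by rewrite addr_ge0// mulr_ge0// ltW.
have ab : e ^+ 2 <= a * b.
  (* Completing the square in [k ^+ 2]. *)
  rewrite -subr_ge0.
  have -> : a * b - e ^+ 2 = (c11 m * c22 m - c12 m ^+ 2) * (k ^+ 2 * y ^+ 2)
      + c33 m / c11 m * ((c11 m * k ^+ 2 - c12 m * y ^+ 2) ^+ 2
      + (c11 m * c22 m - c12 m ^+ 2) * y ^+ 4).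
    by rewrite /a /b /e; field; rewrite gt_eqF.
  apply: addr_ge0; first exact: mulr_ge0 (ltW c12lt) (mulr_ge0 k2 y2).
  apply: mulr_ge0 (divr_ge0 (ltW c33gt0) (ltW c11gt0)) _.
  apply: addr_ge0 (sqr_ge0 _) (mulr_ge0 (ltW c12lt) _).
  exact: exprn_even_ge0.
apply/eqP => E; move: (congr1 (@complex.Re R) E) (congr1 (@complex.Im R) E).
move: a b e a0 b0 ab {E} => a b e a0 b0 ab /= E1 E2.
have {}E1 : (p + a) * (p + b) - q ^+ 2 - e ^+ 2 = 0 by move: E1; lra.
have {}E2 : q * (2 * p + a + b) = 0 by move: E2; lra.
have q0 : q = 0.
  move/eqP: E2; rewrite mulf_eq0 => /orP[/eqP //|/eqP pE2].
  (* Here [p + a = - (p + b)], so [E1] says that a sum of squares vanishes. *)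
  have : q ^+ 2 + e ^+ 2 + (p + b) ^+ 2 = 0.
    have aE : a = - (2 * p + b) by lra.
    by move: E1; rewrite aE; lra.
  have := sqr_ge0 e; have := sqr_ge0 (p + b); have := sqr_ge0 q => H1 H2 H3 H4.
  by apply/eqP; rewrite -sqrf_eq0; apply/eqP; lra.
have Im0 : complex.Im s = 0.
  by apply/eqP; move/eqP: q0; rewrite qE !mulf_eq0 pnatr_eq0
    (gt_eqF rhogt0) (gt_eqF s0) orbF.
(* Now [s] is real, and [(p + a) * (p + b) > a * b >= e ^+ 2] contradicts [E1] with [q = 0]. *)
have : 0 < p by rewrite pE Im0 expr0n subr0 mulr_gt0 ?exprn_gt0.
have := sqr_ge0 e.
by nra.
Qed.

End Symbol.

(** * Continuity of the side indicator over the roots of a quadratic *)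

Section Wedge.
Variable R : realType.
Implicit Types (z w a d : R[i]) (e : R).
Local Notation normc := ComplexField.Normc.normc.

(* For [w = x ^+ 2] this is [2 * Re x * Re (z * x)]: its sign tells whether
   [x] and [z * x] lie on the same side of the imaginary axis. *)
Definition wedge z w : R := complex.Re (z * w) + complex.Re z * normc w.

(** Since [x ^+ 2 + |x| ^+ 2 = 2 * Re x * x], it suffices to multiply by [z] and take real parts. *)
Lemma wedge_sqr z (x : R[i]) :
  wedge z (x ^+ 2) = 2 * (complex.Re x * complex.Re (z * x)).
Proof.
rewrite /wedge.
have -> : normc (x ^+ 2) = complex.Re x ^+ 2 + complex.Im x ^+ 2.
  rewrite expr2 ComplexField.Normc.normcM; case: x => u v /=.
  by rewrite -expr2 sqr_sqrtr // addr_ge0 ?sqr_ge0.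
by case: z x => p q [u v] /=; ring.
Qed.

Lemma Re_le_normc w : complex.Re w <= normc w.
Proof.
rewrite -lecR; have := normc_ge_Re w; rewrite normc_def.
have -> : Num.sqrt (complex.Re w ^+ 2 + complex.Im w ^+ 2) = normc w by case: w.
by apply: le_trans; rewrite lecR ler_norm.
Qed.

Lemma normc_ge0 w : 0 <= normc w.
Proof. by case: w => u v; rewrite sqrtr_ge0. Qed.

Lemma normc_real (x : R) : normc x%:C = `|x|.
Proof. by rewrite /= expr0n addr0 sqrtr_sqr. Qed.

Lemma wedge_lipschitz z w w' :
  wedge z w <= wedge z w' + 2 * normc z * normc (w - w').
Proof.
have h1 := Re_le_normc (z * (w - w')).
rewrite ComplexField.Normc.normcM in h1.
have h2 : complex.Re (z * w) = complex.Re (z * w') + complex.Re (z * (w - w')).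
  by case: (z) (w) (w') => ? ? [? ?] [? ?] /=; ring.
have h3 : `|complex.Re z| <= normc z.
  rewrite ler_norml Re_le_normc andbT lerNl.
  have -> : - complex.Re z = complex.Re (- z) by case: (z).
  by rewrite (le_trans (Re_le_normc _)) // normcN.
have h4 : `|normc w - normc w'| <= normc (w - w').
  have := le_normcD (w - w') w'; have := le_normcD (w' - w) w.
  rewrite !subrK -(normcN (w' - w)) opprB => ? ?.
  by rewrite ler_norml; apply/andP; split; lra.
have : complex.Re z * (normc w - normc w') <= normc z * normc (w - w').
  by rewrite (le_trans (ler_norm _)) // normrM ler_pM.
by rewrite /wedge h2; nra.
Qed.

(** The points [a + sqrtC d] and [a - sqrtC d] solve [(x - a) ^+ 2 = d]. A minimum over both is
    blind to the branch of [sqrtC], hence continuous even where [sqrtC] jumps. *)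
Definition minwedge z a d : R :=
  Num.min (wedge z (a + sqrtC d)) (wedge z (a - sqrtC d)).

Lemma minwedge_le z a d x : (x - a) ^+ 2 = d -> minwedge z a d <= wedge z x.
Proof.
move=> xE; have : (x - a) ^+ 2 == sqrtC d ^+ 2 by rewrite xE sqrtCK.
rewrite eqf_sqr => /orP[]/eqP /(canRL (subrK _)) ->; rewrite [_ + a]addrC.
  by rewrite ge_min lexx.
by rewrite ge_min lexx orbT.
Qed.

Lemma minwedge_root z a d :
  exists2 x, (x - a) ^+ 2 = d & minwedge z a d = wedge z x.
Proof.
rewrite /minwedge; case: leP => _.
  by exists (a + sqrtC d); rewrite // addrAC subrr add0r sqrtCK.
by exists (a - sqrtC d); rewrite // addrAC subrr add0r sqrrN sqrtCK.
Qed.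

(** Square roots are Hölder continuous with exponent 1/2, hence the [e ^+ 2]: the distances from
    [sqrtC d] to the two square roots of [d'] have product [|d - d'|], so one of them is at most
    [e]. *)
Lemma minwedge_holder z a d a' d' e : 0 <= e ->
  normc (a - a') <= e -> normc (d - d') <= e ^+ 2 ->
  minwedge z a d <= minwedge z a' d' + 4 * normc z * e.
Proof.
move=> e0 aa' dd'; have [x' x'E ->] := minwedge_root z a' d'.
have [x xE xx'] : exists2 x, (x - a) ^+ 2 = d & normc (x - x') <= 2 * e.
  have : (normc (sqrtC d - (x' - a')) <= e) ||
      (normc (sqrtC d + (x' - a')) <= e).
    have : normc (sqrtC d - (x' - a')) * normc (sqrtC d + (x' - a')) <= e ^+ 2.
      by rewrite -ComplexField.Normc.normcM -subr_sqr sqrtCK x'E.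
    have := normc_ge0 (sqrtC d + (x' - a')).
    by case: (leP _ e) => //= *; case: (leP _ e) => //= *; nra.
  case/orP => close.
    exists (a + sqrtC d); first by rewrite addrAC subrr add0r sqrtCK.
    have -> : a + sqrtC d - x' = (a - a') + (sqrtC d - (x' - a')) by ring.
    by rewrite (le_trans (le_normcD _ _)) //; lra.
  exists (a - sqrtC d); first by rewrite addrAC subrr add0r sqrrN sqrtCK.
  have -> : a - sqrtC d - x' = (a - a') + - (sqrtC d + (x' - a')) by ring.
  by rewrite (le_trans (le_normcD _ _)) // normcN; lra.
have := minwedge_le z xE; have := wedge_lipschitz z x x'.
by have := normc_ge0 z; nra.
Qed.

Lemma minwedge_continuous z (a0 a1 d0 d1 d2 : R[i]) :
  continuous (fun t : R =>
    minwedge z (a0 + t%:C * a1) (d0 + t%:C * d1 + t%:C ^+ 2 * d2)).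
Proof.
move=> x; apply/cvgrPdist_le => /= eps eps0.
(* A Lipschitz constant for both coefficients within distance 1 of [x], where
   [|x + y| <= 2 * |x| + 1]; the final 1 makes it positive. *)
pose K := normc a1 + normc d1 + normc d2 * (2 * `|x| + 1) + 1.
have := normc_ge0 a1; have := normc_ge0 d1; have := normc_ge0 d2.
have := normr_ge0 x; have := normc_ge0 z => z0 x0 d20 d10 a10.
have d2x0 : 0 <= normc d2 * (2 * `|x| + 1) by rewrite mulr_ge0 //; lra.
have K0 : 0 < K by rewrite /K; lra.
pose e := eps / (4 * normc z + 1).
have e0 : 0 < e by rewrite divr_gt0 //; lra.
have eE : 4 * normc z * e <= eps.
  have : (4 * normc z + 1) * e = eps by rewrite /e; field; lra.
  by nra.
move: e e0 eE => e e0 eE; near=> y.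
have xy1 : `|x - y| <= 1 by near: y; apply: cvgr_dist_le => //; apply: cvg_id.
have xyK : `|x - y| <= e / K.
  by near: y; apply: cvgr_dist_le; [apply: cvg_id | rewrite divr_gt0].
have xyK2 : `|x - y| <= e ^+ 2 / K.
  near: y; apply: cvgr_dist_le; first exact: cvg_id.
  by rewrite divr_gt0 ?exprn_gt0.
rewrite ler_pdivlMr // in xyK; rewrite ler_pdivlMr // in xyK2.
have da (u v : R) :
    normc (a0 + u%:C * a1 - (a0 + v%:C * a1)) = `|u - v| * normc a1.
  by rewrite -normc_real -ComplexField.Normc.normcM; congr normc; ring.
have dd (u v : R) : `|u + v| <= 2 * `|x| + 1 ->
    normc (d0 + u%:C * d1 + u%:C ^+ 2 * d2 - (d0 + v%:C * d1 + v%:C ^+ 2 * d2))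
    <= `|u - v| * K.
  move=> uv.
  have -> : d0 + u%:C * d1 + u%:C ^+ 2 * d2 - (d0 + v%:C * d1 + v%:C ^+ 2 * d2)
     = (u - v)%:C * (d1 + (u + v)%:C * d2) by ring.
  rewrite ComplexField.Normc.normcM normc_real ler_wpM2l //.
  rewrite (le_trans (le_normcD _ _)) // ComplexField.Normc.normcM normc_real /K.
  have : `|u + v| * normc d2 <= (2 * `|x| + 1) * normc d2 by rewrite ler_wpM2r.
  by lra.
have sxy : `|x + y| <= 2 * `|x| + 1.
  have -> : x + y = 2 * x - (x - y) by ring.
  by rewrite (le_trans (ler_normB _ _)) // normrM ger0_norm //; lra.
have aK : `|x - y| * normc a1 <= e.
  by apply: le_trans xyK; rewrite ler_wpM2l // /K; lra.
(* A one-sided estimate, applied to [(x, y)] and to [(y, x)] to bound the absolute value. *)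
have step (u v : R) : `|u - v| * normc a1 <= e -> `|u - v| * K <= e ^+ 2 ->
    `|u + v| <= 2 * `|x| + 1 ->
    minwedge z (a0 + u%:C * a1) (d0 + u%:C * d1 + u%:C ^+ 2 * d2) <=
    minwedge z (a0 + v%:C * a1) (d0 + v%:C * d1 + v%:C ^+ 2 * d2) + eps.
  move=> uva uvK uv; apply: le_trans (lerD (lexx _) eE).
  apply: minwedge_holder (ltW e0) _ _; first by rewrite da.
  by rewrite (le_trans (dd _ _ uv)).
rewrite ler_distlC; apply/andP; split.
  by rewrite lerBlDr; apply: step.
by apply: step; rewrite 1?[y + x]addrC // distrC.
Unshelve. all: by end_near.
Qed.

End Wedge.

(** * Location of the roots along the homotopy *)

Section Roots.
Variables (R : realType) (m : material R).
Implicit Types s k z : R[i].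

(** Completing the square in [x ^+ 2]. The parameter enters only through [t ^+ 2], in which the
    midpoint is affine and the discriminant quadratic. *)
Lemma charF_biquadratic s k : exists a0 a1 d0 d1 d2 : R[i], forall (t : R) x,
  charF m s (t%:C * k) x = 0 <->
  (x ^+ 2 - (a0 + (t ^+ 2)%:C * a1)) ^+ 2 =
    d0 + (t ^+ 2)%:C * d1 + (t ^+ 2)%:C ^+ 2 * d2.
Proof.
pose r := (rho m)%:C : R[i]; pose p := (c11 m)%:C : R[i].
pose q := (c22 m)%:C : R[i]; pose n := (c33 m)%:C : R[i].
pose b := (c12 m)%:C : R[i].
have r0 : r != 0 by rewrite (inj_eq (@complexI R)) gt_eqF ?rho_gt0.
have q0 : q != 0 by rewrite (inj_eq (@complexI R)) gt_eqF ?c22_gt0.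
have n0 : n != 0 by rewrite (inj_eq (@complexI R)) gt_eqF ?c33_gt0.
pose a0 := r * s ^+ 2 * (n + q) / (2 * n * q).
pose a1 := k ^+ 2 * (p * q + n ^+ 2 - (b + n) ^+ 2) / (2 * n * q).
exists a0, a1, (a0 ^+ 2 - (r * s ^+ 2) ^+ 2 / (n * q)).
exists (2 * a0 * a1 - r * s ^+ 2 * (p + n) * k ^+ 2 / (n * q)).
exists (a1 ^+ 2 - p * n * k ^+ 4 / (n * q)) => t x.
have scale0 (c u v : R[i]) : c != 0 -> c * (u - v) = 0 <-> u = v.
  move=> c0; split=> [/eqP|->]; last by rewrite subrr mulr0.
  by rewrite mulf_eq0 (negPf c0) subr_eq0 => /eqP.
(* [n * q / r ^+ 2] is the leading coefficient of [charF] as a polynomial in [x ^+ 2]. *)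
apply: iff_trans (scale0 (n * q / r ^+ 2) _ _ _); last first.
  by rewrite !mulf_neq0 ?invr_eq0 ?expf_neq0.
set lhs := charF _ _ _ _; set rhs := (X in _ <-> X = 0).
suff -> : lhs = rhs by [].
rewrite /lhs /rhs charFE -/r -/p -/q -/n -/b /a0 /a1 rmorphXn /=.
move: t%:C => {}t {a0 a1 lhs rhs}.
move: r p q n b r0 q0 n0 => r p q n b r0 q0 n0.
by field; rewrite ?q0 ?n0 ?r0.
Qed.

(** At [k = 0] the symbol is diagonal: the two polarizations decouple, with moduli [c33] and [c22],
    and each fixes the ratio of [x ^+ 2] to [s ^+ 2]. *)
Lemma charF_k0_root s x : charF m s 0 x = 0 ->
  exists2 c : R, 0 < c & x ^+ 2 = (c%:C * s) ^+ 2.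
Proof.
rewrite charFE expr0n !mulr0 mul0r !addr0 => /eqP.
rewrite mulf_eq0 invr_eq0 expf_eq0 (inj_eq (@complexI R)).
rewrite (gt_eqF (rho_gt0 m)) /=.
have root (c : R) : 0 < c -> (rho m)%:C * s ^+ 2 - c%:C * x ^+ 2 = 0 ->
    exists2 c : R, 0 < c & x ^+ 2 = (c%:C * s) ^+ 2.
  move=> c0 /eqP; rewrite subr_eq0 => /eqP E.
  exists (Num.sqrt (rho m / c)); first by rewrite sqrtr_gt0 divr_gt0 ?rho_gt0.
  rewrite exprMn -rmorphXn /= sqr_sqrtr ?divr_ge0 ?ltW ?rho_gt0 //.
  apply: (@mulfI _ c%:C); first by rewrite (inj_eq (@complexI R)) gt_eqF.
  by rewrite -E [RHS]mulrA -rmorphM /= [c * _]mulrC divfK // gt_eqF.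
rewrite mulf_eq0 => /orP[]/eqP /root; apply; first exact: c33_gt0.
exact: c22_gt0.
Qed.

(** Instead of following single roots, the proof follows the minimum of [wedge] over all of them. It
    is positive at the start and could vanish only at a root with [x] or [z * x] imaginary, so the
    intermediate value theorem keeps it positive. *)
Lemma charF_root_same_side z s k :
  0 < complex.Re s -> 0 < complex.Re (z * s) ->
  (forall (t : R) x, charF m s (t%:C * k) x = 0 ->
     complex.Re x != 0 /\ complex.Re (z * x) != 0) ->
  forall x, charF m s k x = 0 -> 0 < complex.Re x * complex.Re (z * x).
Proof.
move=> s0 zs0 side.
have [a0 [a1 [d0 [d1 [d2 rootE]]]]] := charF_biquadratic s k.
(* The argument of [f] is the square of the homotopy parameter, hence the [Num.sqrt] in [froot]. *)
pose f (t : R) := minwedge z (a0 + t%:C * a1) (d0 + t%:C * d1 + t%:C ^+ 2 * d2).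
have froot (t : R) : 0 <= t -> exists2 x : R[i],
    charF m s ((Num.sqrt t)%:C * k) x = 0 & f t = wedge z (x ^+ 2).
  move=> t0; have [w wE fE] := minwedge_root z (a0 + t%:C * a1)
    (d0 + t%:C * d1 + t%:C ^+ 2 * d2).
  by exists (sqrtC w); rewrite ?sqrtCK // rootE sqrtCK sqr_sqrtr.
have f0 : 0 < f 0.
  have [x] := froot 0 (lexx _); rewrite sqrtr0 rmorph0 mul0r => /charF_k0_root.
  move=> [c c0 ->] ->; rewrite wedge_sqr.
  have -> : z * (c%:C * s) = c%:C * (z * s) by rewrite mulrCA.
  have ReM (u : R[i]) : complex.Re (c%:C * u) = c * complex.Re u.
    by case: u => u v /=; ring.
  by rewrite !ReM mulr_gt0 // mulr_gt0 // mulr_gt0.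
have f1 : 0 < f 1.
  rewrite ltNge; apply/negP => f1.
  have fc : continuous f by exact: minwedge_continuous.
  have [|t t01 ft] := IVT (v := 0) ler01 (continuous_subspaceT fc).
    by rewrite ge_min f1 orbT le_max (ltW f0).
  have [|x /side[x0 zx0]] := froot t; first by have /andP[] := t01.
  rewrite ft wedge_sqr => /esym /eqP.
  by rewrite !mulf_eq0 pnatr_eq0 (negPf x0) (negPf zx0).
move=> x; have := rootE 1 x; rewrite mul1r expr1n => -[xE _] /xE /minwedge_le.
move=> /(_ z); rewrite wedge_sqr => f1x.
by have := lt_le_trans f1 f1x; rewrite pmulr_rgt0.
Qed.

End Roots.

(** * Roots and eigenvectors under scaling *)

Lemma kernel_parallel (K : fieldType) (S : 'M[K]_2) (u v : 'cV[K]_2) :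
  S != 0 -> S *m u = 0 -> S *m v = 0 -> u != 0 -> exists c, v = c *: u.
Proof.
move=> S0 Su Sv u0.
pose N := mx22 (u ord0 ord0) (v ord0 ord0) (u ord_max ord0) (v ord_max ord0).
have SN : S *m N = 0.
  apply/matrixP => i j; move/matrixP/(_ i ord0): Su.
  move/matrixP/(_ i ord0): Sv.
  rewrite !mxE !big_ord_recl !big_ord0 !mxE /=.
  have -> : lift ord0 ord0 = ord_max :> 'I_2 by apply: val_inj.
  by case: (j == ord0).
(* If [u] and [v] were independent, [N] would be invertible and [S *m N = 0] would force [S = 0]. *)
have : \det N = 0.
  apply/eqP; apply: contraNT S0 => detN.
  by rewrite -[S]mulmx1 -(@mulmxV _ _ N) ?unitmxE ?unitfE // mulmxA SN mul0mx.
rewrite det_mx22E => /eqP; rewrite subr_eq0 => /eqP E.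
have ext (c : K) : v ord0 ord0 = c * u ord0 ord0 ->
    v ord_max ord0 = c * u ord_max ord0 -> v = c *: u.
  move=> c0 c1; apply/colP => i; rewrite !mxE.
  by case: i => [[|[|//]] i2]; [move: c0 | move: c1];
     congr (v _ _ = _ * u _ _); apply: val_inj.
have [u00|u00] := eqVneq (u ord0 ord0) 0; last first.
  exists (v ord0 ord0 / u ord0 ord0); apply: ext; rewrite ?divfK //.
  by rewrite mulrAC -E mulrAC divff ?mul1r.
have u10 : u ord_max ord0 != 0.
  apply: contraNneq u0 => u10; apply/eqP/colP => i; rewrite !mxE.
  by case: i => [[|[|//]] i2]; [rewrite -u00 | rewrite -u10];
     congr (u _ _); apply: val_inj.
exists (v ord_max ord0 / u ord_max ord0); apply: ext; rewrite ?divfK //.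
move/eqP: E; rewrite u00 mul0r mulr0 eq_sym mulf_eq0 (negPf u10) orbF.
by move/eqP.
Qed.

Section Modes.
Variables (R : realType) (m : material R).
Implicit Types s k z : R[i].

(** The eigenvectors at the two points are chosen independently; [G] records how roots are matched
    and vectors rescaled or mixed. The factor [z] reflects that the traction has degree one in
    [(k, kappa)]. *)
Lemma eigenvectors_scale z s k (kappa kappa' : 'I_2 -> R[i])
    (Phi Phi' : 'I_2 -> 'cV[R[i]]_2) : z != 0 ->
  (forall j l, symbol m s k (kappa j) = 0 -> kappa l = kappa j) ->
  (forall j, exists l, kappa' j = z * kappa l) ->
  eigenvectors m s k kappa Phi ->
  eigenvectors m (z * s) (z * k) kappa' Phi' ->
  exists G : 'M_2, displacement_mx Phi' = displacement_mx Phi *m G /\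
    traction_mx m (z * k) kappa' Phi' = z *: (traction_mx m k kappa Phi *m G).
Proof.
move=> z0 double perm [eig rank2] [eig' _].
pose N l := kappa l *: Bmx m + ('i%C * k) *: (Cmx m)^T.
have DE l : displacement_mx Phi *m delta_mx l ord0 = Phi l.
  by rewrite -colE; apply/colP => a; rewrite !mxE.
have TE l : traction_mx m k kappa Phi *m delta_mx l ord0 = N l *m Phi l.
  by rewrite -colE; apply/colP => a; rewrite mxE [LHS]mxE.
have colP j : exists g : 'cV_2, Phi' j = displacement_mx Phi *m g /\
    (kappa' j *: Bmx m + ('i%C * (z * k)) *: (Cmx m)^T) *m Phi' j =
      z *: (traction_mx m k kappa Phi *m g).
  have [l kE] := perm j.
  have -> : kappa' j *: Bmx m + ('i%C * (z * k)) *: (Cmx m)^T = z *: N l.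
    by rewrite kE scalerDr !scalerA [z * ('i%C * k)]mulrCA.
  have [_] := eig' j; rewrite kE symbol_scale -scalemxAl => /eqP.
  rewrite scaler_eq0 expf_eq0 (negPf z0) andbF /= => /eqP SPhi'.
  have [Phil0 SPhi] := eig l.
  (* A nonzero symbol has a one-dimensional kernel here, so [Phi' j] is a multiple of [Phi l]. *)
  have [S0|S0] := eqVneq (symbol m s k (kappa l)) 0; last first.
    have [c ->] := kernel_parallel S0 SPhi SPhi' Phil0.
    exists (c *: delta_mx l ord0).
    by rewrite -!scalemxAr DE TE -scalemxAl !scalerA [c * z]mulrC.
  (* If the symbol vanishes, the roots coincide and the rank condition makes [Phi] a basis of the
     plane, in which [Phi' j] is expanded. *)
  have kl i : kappa i = kappa l by apply: double.
  have Dunit : displacement_mx Phi \in unitmx.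
    rewrite -row_full_unit /row_full; apply/eqP/rank2; first by rewrite !kl.
    by rewrite kl S0 mxrank_coker mxrank0.
  exists (invmx (displacement_mx Phi) *m Phi' j); rewrite mulKVmx //; split=> //.
  have -> : traction_mx m k kappa Phi = N l *m displacement_mx Phi.
    apply/matrixP => a i; rewrite !mxE; apply: eq_bigr => b _.
    by rewrite [X in _ = _ * X]mxE /N -(kl i).
  by rewrite -scalemxAl -mulmxA mulKVmx.
have [g gE] := fin_all_exists colP.
exists (\matrix_(l, j) g j l ord0); split; apply/matrixP => a j.
  rewrite !mxE (gE j).1 mxE; apply: eq_bigr => l _;
    by rewrite [in RHS]mxE.
rewrite mxE (gE j).2 !mxE; congr (_ * _); apply: eq_bigr => l _.
by rewrite [in RHS]mxE.
Qed.

Lemma root_split_negP s k kneg kpos x : root_split m s k kneg kpos ->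
  charF m s k x = 0 -> complex.Re x < 0 -> exists l, x = kneg l.
Proof.
case=> [[c c0 FE] signs] /eqP; rewrite FE mulf_eq0 (negPf c0) /= => /prodf_eq0.
move=> [l _]; rewrite mulf_eq0 !subr_eq0 => /orP[]/eqP -> x0; first by exists l.
by have := (signs l).2; rewrite ltNge ltW.
Qed.

Lemma root_split_posP s k kneg kpos x : root_split m s k kneg kpos ->
  charF m s k x = 0 -> 0 < complex.Re x -> exists l, x = kpos l.
Proof.
case=> [[c c0 FE] signs] /eqP; rewrite FE mulf_eq0 (negPf c0) /= => /prodf_eq0.
move=> [l _]; rewrite mulf_eq0 !subr_eq0 => /orP[]/eqP -> x0; last by exists l.
by have := (signs l).1; rewrite ltNge ltW.
Qed.

Lemma root_split_roots s k kneg kpos : root_split m s k kneg kpos ->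
  (forall l, charF m s k (kneg l) = 0) /\ (forall l, charF m s k (kpos l) = 0).
Proof.
case=> [[c c0 FE] _]; split=> l; rewrite FE (bigD1 l) //= subrr.
  by rewrite !(mul0r, mulr0).
by rewrite !(mul0r, mulr0).
Qed.

Lemma root_split_scale z s k kneg kpos : z != 0 ->
  (forall x, charF m s k x = 0 -> 0 < complex.Re x * complex.Re (z * x)) ->
  root_split m s k kneg kpos ->
  root_split m (z * s) (z * k) (fun j => z * kneg j) (fun j => z * kpos j).
Proof.
move=> z0 side split_sk; have [kneg0 kpos0] := root_split_roots split_sk.
case: split_sk => [[c c0 FE] signs]; split=> [|j].
  (* The factor [z ^+ 4] is shared out among the four linear factors, so the constant stays [c]. *)
  exists c => // x; rewrite -{1}[x](mulVKf z0) charF_scale FE mulrCA.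
  congr (_ * _).
  rewrite !big_ord_recl !big_ord0 !mulr1.
  have zE y : x - z * y = z * (z^-1 * x - y) by rewrite mulrBr mulVKf.
  by rewrite !zE; ring.
have [neg pos] := signs j; split.
  by have := side _ (kneg0 j); rewrite nmulr_rgt0.
by have := side _ (kpos0 j); rewrite pmulr_rgt0.
Qed.

(** Supplies the double-root hypothesis of [eigenvectors_scale]: a vanishing symbol leaves only
    [kappa j] and [- kappa j], and the latter lies on the wrong side of the imaginary axis. *)
Lemma symbol0_eq_root s k (kappa : 'I_2 -> R[i]) (j l : 'I_2) :
  (forall i, charF m s k (kappa i) = 0) ->
  0 < complex.Re (kappa j) * complex.Re (kappa l) ->
  symbol m s k (kappa j) = 0 -> kappa l = kappa j.
Proof.
move=> roots jl0 S0; have kj0 : kappa j != 0.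
  by apply: contraTneq jl0 => ->; rewrite mul0r ltxx.
have [//|E] := symbol0_double kj0 S0 (roots l); move: jl0; rewrite E.
have -> : complex.Re (- kappa j) = - complex.Re (kappa j) by case: (kappa j).
by rewrite mulrN oppr_gt0 -expr2 ltNge sqr_ge0.
Qed.

End Modes.

(** * Sign properties of the damping factor and of the damped roots *)

Section Damping.
Variables (R : realType) (sigma alpha : R).
Hypotheses (sigma_ge0 : 0 <= sigma) (alpha_ge0 : 0 <= alpha).
Variable s : R[i].
Hypothesis s_gt0 : 0 < complex.Re s.

Lemma Re_Sx_gt0 : 0 < complex.Re (Sx sigma alpha s).
Proof.
case: s s_gt0 => x y /= x0; rewrite mul0r subr0 add0r.
have ax0 : 0 < alpha + x by rewrite ltr_wpDl.
have D0 : 0 < (alpha + x) ^+ 2 + y ^+ 2.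
  exact: ltr_wpDr (sqr_ge0 y) (exprn_gt0 2 ax0).
by rewrite ltr_wpDr // mulr_ge0 // divr_ge0 // ltW.
Qed.

(** The term added to [s] is [sigma * s / (alpha + s)]. For [s = x + i y], the product of [s] with
    the conjugate of [alpha + s] has real part [(alpha + x) * x + y ^+ 2 >= 0]. *)
Lemma Re_Sx_mul_gt0 : 0 < complex.Re (Sx sigma alpha s * s).
Proof.
case: s s_gt0 => x y /= x0; rewrite !mul0r subr0 addr0 !add0r.
set D := _ + y ^+ 2.
have ax0 : 0 < alpha + x by rewrite ltr_wpDl.
have D0 : 0 < D := ltr_wpDr (sqr_ge0 y) (exprn_gt0 2 ax0).
have -> : (1 + sigma * ((alpha + x) / D)) * x - sigma * - (y / D) * y
    = x + sigma * (((alpha + x) * x + y ^+ 2) / D) by ring.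
rewrite ltr_wpDr // mulr_ge0 // divr_ge0 ?(ltW D0) //.
by rewrite addr_ge0 ?sqr_ge0 // mulr_ge0 // ltW.
Qed.

Lemma damped_roots_same_side (m : material R) (kx : R) x :
  no_growing_Cauchy_modes sigma alpha m ->
  charF m s (kx%:C / Sx sigma alpha s) x = 0 ->
  0 < complex.Re x * complex.Re (Sx sigma alpha s * x).
Proof.
move=> cauchy; have := Re_Sx_gt0; have := Re_Sx_mul_gt0.
set z := Sx _ _ _ => zs0 z_gt0.
have z0 : z != 0 by apply: contraTneq z_gt0 => ->; rewrite ltxx.
have imag (u : R[i]) : complex.Re u = 0 -> u = 'i%C * (complex.Im u)%:C.
  by move=> u0; rewrite [LHS]complexE u0 add0r.
apply: charF_root_same_side => // t {}x Fx; split; apply/eqP => /imag xE.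
  (* An imaginary root would be a growing Cauchy mode with wavenumbers [t * kx] and [Im x]. *)
  apply: cauchy; exists (t * kx), (complex.Im x), s; split=> //.
  by rewrite rmorphM /= -mulrA -xE.
(* If [z * x] is imaginary, scaling by [z] yields an imaginary root of the undamped problem at
   [(z * s, t * kx)]. *)
have /eqP := charF_imaginary_neq0 m (t * kx) (complex.Im (z * x)) zs0; apply.
rewrite -xE rmorphM /=.
have -> : t%:C * kx%:C = z * (t%:C * (kx%:C / z)).
  by rewrite mulrCA [z * _]mulrC divfK.
by rewrite charF_scale Fx mulr0.
Qed.

End Damping.

(** * Transfer of the interface determinant *)

Lemma interface_root_scale (R : realType) (m1 m2 : material R)
    (M : interface_modes m1 m2) (z s k : R[i]) : z != 0 ->
  (forall x, charF m1 s k x = 0 -> 0 < complex.Re x * complex.Re (z * x)) ->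
  (forall x, charF m2 s k x = 0 -> 0 < complex.Re x * complex.Re (z * x)) ->
  interface_root M s k -> interface_root M (z * s) (z * k).
Proof.
move=> z0 side1 side2 [sp1 sp2 det0].
have rs1 := roots1 M sp1; have rs2 := roots2 M sp2.
have zrs1 := root_split_scale z0 side1 rs1.
have zrs2 := root_split_scale z0 side2 rs2.
have zsp1 : splits m1 (z * s) (z * k) by do 2!eexists; exact: zrs1.
have zsp2 : splits m2 (z * s) (z * k) by do 2!eexists; exact: zrs2.
split; [exact: zsp1 | exact: zsp2 | ].
have [G1 [D1 T1]] : exists G : 'M_2,
    displacement_mx (Phi1 M (z * s) (z * k)) =
      displacement_mx (Phi1 M s k) *m G /\
    traction_mx m1 (z * k) (kneg1 M (z * s) (z * k)) (Phi1 M (z * s) (z * k)) =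
      z *: (traction_mx m1 k (kneg1 M s k) (Phi1 M s k) *m G).
  apply: eigenvectors_scale z0 _ _ (eigen1 M sp1) (eigen1 M zsp1) => [j l|j].
    apply: symbol0_eq_root; first exact: (root_split_roots rs1).1.
    by rewrite nmulr_rgt0 ?(rs1.2 _).1.
  apply: root_split_negP zrs1 ((root_split_roots (roots1 M zsp1)).1 j) _.
  exact: ((roots1 M zsp1).2 j).1.
have [G2 [D2 T2]] : exists G : 'M_2,
    displacement_mx (Phi2 M (z * s) (z * k)) =
      displacement_mx (Phi2 M s k) *m G /\
    traction_mx m2 (z * k) (kpos2 M (z * s) (z * k)) (Phi2 M (z * s) (z * k)) =
      z *: (traction_mx m2 k (kpos2 M s k) (Phi2 M s k) *m G).
  apply: eigenvectors_scale z0 _ _ (eigen2 M sp2) (eigen2 M zsp2) => [j l|j].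
    apply: symbol0_eq_root; first exact: (root_split_roots rs2).2.
    by rewrite pmulr_rgt0 ?(rs2.2 _).2.
  apply: root_split_posP zrs2 ((root_split_roots (roots2 M zsp2)).2 j) _.
  exact: ((roots2 M zsp2).2 j).2.
(* The left factor scales the traction rows by [z]; the right factor recombines the columns of each
   layer. *)
have -> : interface_det M (z * s) (z * k) =
    \det (block_mx 1%:M 0 0 z%:M *m interface_mx M s k *m block_mx G1 0 0 G2).
  rewrite /interface_det /interface_mx D1 D2 T1 T2 !mulmx_block.
  by rewrite !(mul0mx, mulmx0, addr0, add0r, mul1mx, mul_scalar_mx) !mulNmx
    scalerN mulNmx -!scalemxAl.
by rewrite !det_mulmx -/(interface_det M s k) det0 mulr0 mul0r.
Qed.

Theorem theorem6 (R : realType) (sigma alpha : R) (m1 m2 : material R)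
    (M : interface_modes m1 m2)
    (sigma_ge0 : 0 <= sigma) (alpha_ge0 : 0 <= alpha)
    (cauchy1 : no_growing_Cauchy_modes sigma alpha m1)
    (cauchy2 : no_growing_Cauchy_modes sigma alpha m2)
    (undamped_stable : forall (kx : R) (s : R[i]),
       interface_root M s kx%:C -> exists xi : R, s = 'i%C * xi%:C) :
  forall (kx : R) (s : R[i]),
    interface_root M s (kx%:C / Sx sigma alpha s) -> complex.Re s <= 0.
Proof.
move=> kx s root; rewrite leNgt; apply/negP => s0.
have z_gt0 := Re_Sx_gt0 sigma_ge0 alpha_ge0 s0.
have zs_gt0 := Re_Sx_mul_gt0 sigma_ge0 alpha_ge0 s0.
have z0 : Sx sigma alpha s != 0 by apply: contraTneq z_gt0 => ->; rewrite ltxx.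
have side m := @damped_roots_same_side _ _ _ sigma_ge0 alpha_ge0 _ s0 m kx.
have := interface_root_scale z0 (fun x => side m1 x cauchy1)
  (fun x => side m2 x cauchy2) root.
(* The scaled wavenumber is the real number [kx], so undamped stability applies at
   [Sx sigma alpha s * s]. *)
rewrite mulrC [_ * (_ / _)]mulrC divfK // => /undamped_stable[xi zsE].
by move: zs_gt0; rewrite mulrC zsE /= mul0r mul1r subrr ltxx.
Qed.
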